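(* Let $G=(N,E)$ be any finite undirected graph with $N=\{1,\dots,n\}$, let $\alpha\in\mathbb{R}$, and let a fixed intelligent adversary with capability $k$ influence a fixed set $S\subseteq N$ with $|S|=k$. Consider log-linear learning in the graphical coordination game $(G,\alpha)$ influenced by $S$. 1. The joint action $\vec{x}$ is strictly stochastically stable if and only if for all $T\subseteq N$ with $T\neq\emptyset$, $$\alpha > \frac{|T\cap S| - d(T,N\setminus T)}{d(T,N)}.$$ 2. The joint action $\vec{y}$ is strictly stochastically stable if and only if for all $T\subset N$ with $T\neq N$, $$\alpha < \frac{d(T,N\setminus T) + k - |T\cap S|}{d(N\setminus T,N\setminus T)}.$$
   Context: For $A,B\subseteq N$, $d(A,B):=|\{\{i,j\}\in E : i\in A,\ j\in B\}|$ is the number of (undirected) edges with one endpoint in $A$ and the other in $B$ (so $d(N,N)=|E|$). Graphical coordination game $(G,\alpha)$: agents $N$ each choose an action in $\{x,y\}$; joint action space $\mathcal{A}=\{x,y\}^n$. The two-player payoff is $u(x,x)=1+\alpha$, $u(y,y)=1$, $u(x,y)=u(y,x)=0$. With $\mathcal{N}_i=\{j:\{i,j\}\in E\}$, $U_i(a)=\sum_{j\in\mathcal{N}_i}u(a_i,a_j)$. Write $\vec{x}=(x,\dots,x)$, $\vec{y}=(y,\dots,y)$. Adversarial influence: for an influence set $S\subseteq N$, the influenced utility is $\tilde U_i(a,S)=U_i(a)+1$ if $i\in S$ and $a_i=y$, and $\tilde U_i(a,S)=U_i(a)$ otherwise. The capability $k$ is the number of agents the adversary influences. A fixed intelligent adversary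 uses the same set $S$ at all times. Log-linear learning with parameter $\beta>0$: at each time $t=0,1,2,\dots$ an agent $i$ is selected uniformly at random from $N$; all other agents keep their actions, and agent $i$ chooses its next action to be $x$ with probability $$\frac{e^{\beta \tilde U_i((x,a_{-i}),S)}}{e^{\beta \tilde U_i((x,a_{-i}),S)}+e^{\beta \tilde U_i((y,a_{-i}),S)}}$$ and $y$ otherwise, where $a=a(t)$ is the current joint action and $a_{-i}$ denotes the actions of the agents other than $i$. This is an irreducible aperiodic Markov chain on $\mathcal{A}$ with unique stationary distribution $\pi_\beta$; let $\pi=\lim_{\beta\to\infty}\pi_\beta$. A joint action $a$ is strictly stochastically stable if $\pi(a)=1$.
   Formalization: Where d(T,N)=0 or d(N∖T,N∖T)=0 the quotient is undefined; there the inequality is read cross-multiplied, i.e. as |T∩S|−d(T,N∖T)<0 in part 1 and d(T,N∖T)+k−|T∩S|>0 in part 2. *)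

(* Defs.v *)
(* MathComp world, with MathComp-Analysis for the exponential and limits. *)
From mathcomp Require Import all_boot all_order all_algebra.
From mathcomp Require Import all_classical all_reals all_analysis.
Import Order.TTheory GRing.Theory Num.Theory.
Import numFieldNormedType.Exports.

Set Implicit Arguments.
Unset Strict Implicit.
Unset Printing Implicit Defensive.

Local Open Scope ring_scope.

(* A graph on the agents 'I_n is given by its set of edges, an edge being an
   unordered pair of distinct agents. *)
Definition simple_graph (n : nat) (E : {set {set 'I_n}}) : Prop :=
  forall e, e \in E -> #|e| = 2.

Definition neighbours (n : nat) (E : {set {set 'I_n}}) (i : 'I_n) :
    {set 'I_n} :=
  [set j | [set i; j] \in E].

(* Each undirected edge counts once, even if both its endpoints lie in
   A :&: B. *)
Definition edge_count (n : nat) (E : {set {set 'I_n}}) (A B : {set 'I_n}) :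
    nat :=
  #|[set e in E | [exists i in A, exists j in B, e == [set i; j]]]|.

Notation action := bool (only parsing).
Definition act_x : action := true.
Definition act_y : action := false.

Notation joint_action n := {ffun 'I_n -> action}.

Definition all_x (n : nat) : joint_action n := [ffun _ => act_x].
Definition all_y (n : nat) : joint_action n := [ffun _ => act_y].

(* The joint action (c, a_{-i}). *)
Definition deviate (n : nat) (a : joint_action n) (i : 'I_n) (c : action) :
    joint_action n :=
  [ffun j => if j == i then c else a j].

Definition payoff (R : realType) (alpha : R) (c c' : action) : R :=
  match c, c' with
  | true, true => 1 + alpha
  | false, false => 1
  | _, _ => 0
  end.

Definition utility (R : realType) (n : nat) (E : {set {set 'I_n}}) (alpha : R)
    (i : 'I_n) (a : joint_action n) : R :=
  \sum_(j in neighbours E i) payoff alpha (a i) (a j).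

Definition influenced_utility (R : realType) (n : nat) (E : {set {set 'I_n}})
    (alpha : R) (S : {set 'I_n}) (i : 'I_n) (a : joint_action n) : R :=
  if (i \in S) && (a i == act_y) then utility E alpha i a + 1
  else utility E alpha i a.

(* The probability that the selected agent i moves to x when the current joint
   action is a. *)
Definition prob_x (R : realType) (n : nat) (E : {set {set 'I_n}}) (alpha : R)
    (S : {set 'I_n}) (beta : R) (a : joint_action n) (i : 'I_n) : R :=
  let wx := expR (beta * influenced_utility E alpha S i (deviate a i act_x)) in
  let wy := expR (beta * influenced_utility E alpha S i (deviate a i act_y)) in
  wx / (wx + wy).

(* One-step transition probability from a to b of log-linear learning; for
   b = a every agent i contributes the probability of keeping its action. *)
Definition transition (R : realType) (n : nat) (E : {set {set 'I_n}})
    (alpha : R) (S : {set 'I_n}) (beta : R) (a b : joint_action n) : R :=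
  \sum_(i < n) n%:R^-1 *
    (prob_x E alpha S beta a i * (b == deviate a i act_x)%:R
     + (1 - prob_x E alpha S beta a i) * (b == deviate a i act_y)%:R).

Definition stationary (R : realType) (T : finType) (P : T -> T -> R)
    (mu : T -> R) : Prop :=
  [/\ forall a, 0 <= mu a,
      \sum_a mu a = 1
    & forall b, \sum_a mu a * P a b = mu b].

(* pi is the limit, as beta tends to +oo, of the stationary distributions
   pi_beta. That pi_beta exists and is unique for every beta > 0 is part of the
   definition, so that it never holds vacuously. *)
Definition limit_distribution (R : realType) (n : nat) (E : {set {set 'I_n}})
    (alpha : R) (S : {set 'I_n}) (pi : joint_action n -> R) : Prop :=
  exists pi_ : R -> joint_action n -> R,
    (forall beta, 0 < beta ->
       unique (stationary (transition E alpha S beta)) (pi_ beta)) /\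
    (forall a, (pi_ beta a @[beta --> +oo] --> pi a)%classic).

Definition strictly_stochastically_stable (R : realType) (n : nat)
    (E : {set {set 'I_n}}) (alpha : R) (S : {set 'I_n}) (a : joint_action n) :
    Prop :=
  exists pi, limit_distribution E alpha S pi /\ pi a = 1.

(* The inequalities a > p / q and a < p / q for q >= 0. In MathComp p / 0 = 0;
   for q = 0 they are read instead as a * q > p and a * q < p. So p / 0 is +oo
   for p > 0 and -oo for p < 0, and neither inequality holds for 0 / 0. The
   case q = 0 does occur: edge_count E T [set: 'I_n] = 0 when T consists of
   isolated agents, and edge_count E (~: T) (~: T) = 0 when ~: T is
   independent. *)
Definition gt_quot (R : realType) (a p q : R) : Prop :=
  if q == 0 then 0 > p else a > p / q.
Definition lt_quot (R : realType) (a p q : R) : Prop :=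
  if q == 0 then 0 < p else a < p / q.

(* Main.v *)
(** Log-linear learning is reversible with respect to the Gibbs weights
    exp (beta V), where the potential V counts the edges, weighted by the payoff
    on which their endpoints agree, plus the influenced agents playing y.
    Single-agent moves connect all joint actions, so the Gibbs distribution is
    the unique stationary distribution, and it concentrates on one joint action
    exactly when that action is the unique maximiser of V. If T is the set of
    agents playing y, then, as every edge lies in T, in ~T or across,
    V(x) - V(T) = alpha d(T, N) + d(T, ~T) - |T n S| and
    V(y) - V(T) = d(T, ~T) + k - |T n S| - alpha d(~T, ~T). *)
Require Import Defs.
From mathcomp Require Import all_boot all_order all_algebra.
From mathcomp Require Import all_classical all_reals all_analysis.
From mathcomp Require Import ring lra.
Import Order.TTheory GRing.Theory Num.Theory.
Import numFieldNormedType.Exports.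

Set Implicit Arguments.
Unset Strict Implicit.
Unset Printing Implicit Defensive.

Local Open Scope ring_scope.

(* Reversibility makes mu / w harmonic, so by the maximum principle it takes
   its maximal value at every state reachable from a maximiser. *)
Lemma reversible_unique_stationary (R : realType) (T : finType) (x0 : T)
    (P : T -> T -> R) (w : T -> R) :
  (forall a, 0 < w a) ->
  (forall a b, 0 <= P a b) ->
  (forall a, \sum_b P a b = 1) ->
  (forall a b, w a * P a b = w b * P b a) ->
  (forall a b, connect [rel c d | 0 < P c d] a b) ->
  unique (stationary P) (fun a => w a / \sum_b w b).
Proof.
move=> w_gt0 P_ge0 P_sum1 w_rev P_conn.
have W_gt0 : 0 < \sum_b w b.
  rewrite (bigD1 x0) //= ltr_wpDr // sumr_ge0 // => b _; exact: ltW.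
have w_neq0 a : w a != 0 by rewrite gt_eqF.
split.
  split=> [a||b]; first by rewrite divr_ge0 // ltW.
    by rewrite -mulr_suml divff // gt_eqF.
  under eq_bigr => a _ do rewrite mulrAC w_rev.
  by rewrite -mulr_suml -mulr_sumr P_sum1 mulr1.
move=> mu [_ mu_sum1 mu_stat].
pose f a := mu a / w a.
have f_harmonic b : \sum_a P b a * f a = f b.
  rewrite /f -(mu_stat b) mulr_suml; apply: eq_bigr => a _.
  by rewrite -[P b a](mulKf (w_neq0 b)) -w_rev; field; rewrite !w_neq0.
have [m _ f_max] := arg_maxP f (isT : xpredT x0).
have f_step b c : f b = f m -> 0 < P b c -> f c = f m.
  move=> fb Pbc; have f_le a : 0 <= P b a * (f m - f a).
    by apply: mulr_ge0 => //; rewrite subr_ge0; exact: f_max.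
  have sum0 : \sum_a P b a * (f m - f a) = 0.
    under eq_bigr => a _ do rewrite mulrBr.
    by rewrite sumrB f_harmonic -mulr_suml P_sum1 mul1r fb subrr.
  have /(_ c isT)/eqP := psumr_eq0P (fun a _ => f_le a) sum0.
  by rewrite mulf_eq0 gt_eqF //= subr_eq0 => /eqP ->.
have f_const b : f b = f m.
  have /connectP [p + ->] := P_conn m b.
  have: f m = f m by [].
  elim: p {1 3 4}m => [|c p IHp] a fa //= /andP[Pac].
  by apply: IHp; exact: f_step Pac.
have mu_eq a : mu a = w a * f m.
  by rewrite -(f_const a) /f; field; rewrite w_neq0.
have fm : f m = (\sum_b w b)^-1.
  apply: (mulfI (lt0r_neq0 W_gt0)); rewrite divff ?gt_eqF // -mu_sum1 mulr_suml.
  by apply: eq_bigr => a _; rewrite mu_eq.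
by apply/funext => a; rewrite mu_eq fm.
Qed.

Definition gibbs (R : realType) (T : finType) (V : T -> R) (beta : R) (a : T) :
    R :=
  expR (beta * V a) / \sum_b expR (beta * V b).

Lemma gibbs_norm_gt0 (R : realType) (T : finType) (V : T -> R) (beta : R)
    (a : T) : 0 < \sum_b expR (beta * V b).
Proof.
rewrite (bigD1 a) //= ltr_wpDr ?expR_gt0 //.
by apply: sumr_ge0 => b _; exact: expR_ge0.
Qed.

Lemma sum_gibbs (R : realType) (T : finType) (V : T -> R) (beta : R) (a : T) :
  \sum_b gibbs V beta b = 1.
Proof. by rewrite -mulr_suml divff // gt_eqF // (gibbs_norm_gt0 _ _ a). Qed.

Lemma gibbs_ge0 (R : realType) (T : finType) (V : T -> R) (beta : R) (a : T) :
  0 <= gibbs V beta a.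
Proof. by rewrite divr_ge0 ?expR_ge0 // ltW // (gibbs_norm_gt0 _ _ a). Qed.

Lemma gibbs_cvg0 (R : realType) (T : finType) (V : T -> R) (m a : T) :
  V a < V m -> (gibbs V beta a @[beta --> +oo] --> (0 : R))%classic.
Proof.
move=> Vam.
apply: (@squeeze_cvgr _ _ _ _ (cst 0)
  (fun beta => expR (- ((V m - V a) * beta)))).
- near=> beta; rewrite gibbs_ge0 /= ler_pdivrMr ?(gibbs_norm_gt0 _ _ a) //.
  rewrite (bigD1 m) //= mulrDr -expRD.
  have -> : - ((V m - V a) * beta) + beta * V m = beta * V a by ring.
  rewrite lerDl mulr_ge0 ?expR_ge0 // sumr_ge0 // => b _; exact: expR_ge0.
- exact: cvg_cst.
- apply: (@cvg_comp _ _ _ (fun beta => (V m - V a) * beta) (fun x => expR (- x))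
    _ +oo%R); last exact: cvgr_expR.
  by apply: gt0_cvgMry; rewrite ?subr_gt0 //; exact: cvg_id.
Unshelve. all: by end_near. Qed.

Lemma gibbs_cvg1 (R : realType) (T : finType) (V : T -> R) (m : T) :
  (forall a, a != m -> V a < V m) ->
  (gibbs V beta m @[beta --> +oo] --> (1 : R))%classic.
Proof.
move=> m_max.
have -> : (fun beta => gibbs V beta m) =
    (fun beta => 1 - \sum_(a | a != m) gibbs V beta a).
  by apply/funext => beta; rewrite -(sum_gibbs V beta m) (bigD1 m) //= addrK.
suff: (1 - \sum_(a | a != m) gibbs V beta a @[beta --> +oo] -->
    (1 : R) - \sum_(a : T | a != m) 0)%classic by rewrite big1 // subr0.
apply: cvgB; first exact: cvg_cst.
apply: cvg_big => [|a am]; first exact: add_continuous.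
exact/gibbs_cvg0/m_max.
Qed.

Lemma gibbs_cvg1_max (R : realType) (T : finType) (V : T -> R) (m a : T) :
  a != m -> (gibbs V beta m @[beta --> +oo] --> (1 : R))%classic -> V a < V m.
Proof.
move=> am m_cvg; rewrite ltNge; apply/negP => Vma.
suff: (1 : R) <= 1 / 2%:R by lra.
apply: cvgr_to_le m_cvg _; near=> beta.
have := sum_gibbs V beta m; rewrite (bigD1 m) //= (bigD1 a) //=.
have : gibbs V beta m <= gibbs V beta a.
  by rewrite ler_pM2r ?invr_gt0 ?(gibbs_norm_gt0 _ _ a) // ler_expR ler_wpM2l.
have : 0 <= \sum_(b | (b != m) && (b != a)) gibbs V beta b.
  by apply: sumr_ge0 => b _; exact: gibbs_ge0.
lra.
Unshelve. all: by end_near. Qed.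

Definition prob (R : realType) (n : nat) (E : {set {set 'I_n}}) (alpha : R)
    (S : {set 'I_n}) (beta : R) (a : joint_action n) (i : 'I_n) (c : bool) :
    R :=
  if c then prob_x E alpha S beta a i else 1 - prob_x E alpha S beta a i.

Definition potential (R : realType) (n : nat) (E : {set {set 'I_n}}) (alpha : R)
    (S : {set 'I_n}) (a : joint_action n) : R :=
  \sum_(e in E) ((1 + alpha) *+ (e \subset [set i | a i])
                 + (e \subset [set i | ~~ a i])%:R)
  + \sum_(i in S) (~~ a i)%:R.

Lemma set2_inj (T : finType) (i : T) (A : {set T}) :
  i \notin A -> {in A &, injective (fun j => [set i; j])}.
Proof.
move=> iA j k jA kA /setP /(_ j); rewrite !inE eqxx orbT.
by case: (eqVneq j i) => [ji|_ /esym /eqP //]; rewrite -ji jA in iA.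
Qed.

Lemma notin_neighbours (n : nat) (E : {set {set 'I_n}}) (i : 'I_n) :
  simple_graph E -> i \notin neighbours E i.
Proof.
by move=> hE; rewrite inE finset.setUid; apply/negP => /hE; rewrite cards1.
Qed.

Lemma sum_edges_at (R : realType) (n : nat) (E : {set {set 'I_n}}) (i : 'I_n)
    (F : {set 'I_n} -> R) : simple_graph E ->
  \sum_(e in E | i \in e) F e = \sum_(j in neighbours E i) F [set i; j].
Proof.
move=> hE; rewrite -(big_imset _ (set2_inj (notin_neighbours i hE))).
apply: eq_bigl => e; apply/andP/imsetP => [[eE ie]|[j + ->]]; last first.
  by rewrite !inE eqxx.
have /eqP/cards2P [j [k [jk e_def]]] := hE e eE.
move: ie; rewrite e_def !inE => /orP[] /eqP ->.
  by exists k; rewrite // inE -e_def.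
by exists j; rewrite 1?finset.setUC // inE finset.setUC -e_def.
Qed.

Lemma utility_potential (R : realType) (n : nat) (E : {set {set 'I_n}})
    (alpha : R) (S : {set 'I_n}) (i : 'I_n) (a : joint_action n) (c c' : bool) :
  simple_graph E ->
  potential E alpha S (deviate a i c) - potential E alpha S (deviate a i c') =
  influenced_utility E alpha S i (deviate a i c)
  - influenced_utility E alpha S i (deviate a i c').
Proof.
move=> hE.
pose rest := \sum_(e in E | i \notin e)
    ((1 + alpha) *+ (e \subset [set j | a j])
     + (e \subset [set j | ~~ a j])%:R)
  + \sum_(j in S | j != i) (~~ a j)%:R.
suff dec d : potential E alpha S (deviate a i d) =
    influenced_utility E alpha S i (deviate a i d) + rest.
  by rewrite !dec; ring.
have edges_off : \sum_(e in E | i \notin e)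
    ((1 + alpha) *+ (e \subset [set j | deviate a i d j])
     + (e \subset [set j | ~~ deviate a i d j])%:R) =
  \sum_(e in E | i \notin e)
    ((1 + alpha) *+ (e \subset [set j | a j])
     + (e \subset [set j | ~~ a j])%:R).
  apply: eq_bigr => e /andP[_ ie].
  have off j : j \in e -> deviate a i d j = a j.
    by move=> je; rewrite ffunE; case: eqP je ie => // -> ->.
  congr (_ *+ _ + _%:R); congr nat_of_bool.
    by apply/fintype.subsetP/fintype.subsetP => sub j je;
      have := sub j je; rewrite !inE off.
  by apply/fintype.subsetP/fintype.subsetP => sub j je;
    have := sub j je; rewrite !inE off.
have edges_at : \sum_(e in E | i \in e)
    ((1 + alpha) *+ (e \subset [set j | deviate a i d j])
     + (e \subset [set j | ~~ deviate a i d j])%:R) =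
  utility E alpha i (deviate a i d).
  rewrite sum_edges_at //; apply: eq_bigr => j _.
  rewrite !finset.subUset !finset.sub1set !inE.
  by case: (deviate a i d i); case: (deviate a i d j);
    rewrite ?mulr1n ?mulr0n ?addr0 ?add0r.
have agents_off : \sum_(j in S | j != i) (~~ deviate a i d j)%:R =
    \sum_(j in S | j != i) (~~ a j)%:R :> R.
  by apply: eq_bigr => j /andP[_ /negPf ji]; rewrite ffunE ji.
rewrite /potential (bigID (fun e : {set 'I_n} => i \in e)) /=.
rewrite edges_off edges_at.
rewrite /rest /influenced_utility /act_y.
case: (boolP (i \in S)) => iS /=.
  rewrite (bigD1 i iS) /= agents_off.
  by case: (deviate a i d i) => /=; ring.
rewrite -agents_off [X in _ + X](_ : _ =
  \sum_(j in S | j != i) (~~ deviate a i d j)%:R); first by ring.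
apply: eq_bigl => j; case: (eqVneq j i) => [->|]; last by rewrite andbT.
by rewrite (negPf iS).
Qed.

Lemma prob_gibbs (R : realType) (n : nat) (E : {set {set 'I_n}}) (alpha : R)
    (S : {set 'I_n}) (beta : R) (a : joint_action n) (i : 'I_n) (c : bool) :
  simple_graph E ->
  let w b := expR (beta * potential E alpha S b) in
  prob E alpha S beta a i c =
  w (deviate a i c) / (w (deviate a i true) + w (deviate a i false)).
Proof.
move=> hE w.
have p_x : prob_x E alpha S beta a i =
    w (deviate a i true) / (w (deviate a i true) + w (deviate a i false)).
  rewrite /prob_x /w /act_x /act_y.
  have := utility_potential alpha S i a true false hE.
  set Vx := potential _ _ _ _; set Vy := potential _ _ _ _.
  set Ux := influenced_utility _ _ _ _ _.
  set Uy := influenced_utility _ _ _ _ _.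
  move=> VU; have -> : beta * Vx = (beta * (Vx - Ux)) + beta * Ux by ring.
  have -> : beta * Vy = (beta * (Vx - Ux)) + beta * Uy.
    by rewrite -mulrDr; congr (_ * _); lra.
  have x_gt0 := expR_gt0 (beta * Ux); have y_gt0 := expR_gt0 (beta * Uy).
  have s_gt0 := expR_gt0 (beta * (Vx - Ux)).
  rewrite !expRD; field.
  by rewrite -mulrDr mulf_neq0 ?gt_eqF ?addr_gt0.
case: c => //=; rewrite p_x.
have x_gt0 : 0 < w (deviate a i true) by exact: expR_gt0.
have y_gt0 : 0 < w (deviate a i false) by exact: expR_gt0.
by field; rewrite gt_eqF ?addr_gt0.
Qed.

Lemma deviate_self (n : nat) (a : joint_action n) (i : 'I_n) :
  deviate a i (a i) = a.
Proof. by apply/ffunP => j; rewrite ffunE; case: eqP => // ->. Qed.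

Lemma deviate_deviate (n : nat) (a : joint_action n) (i : 'I_n) (c d : bool) :
  deviate (deviate a i c) i d = deviate a i d.
Proof. by apply/ffunP => j; rewrite !ffunE; case: eqP. Qed.

Lemma deviate_at (n : nat) (a : joint_action n) (i : 'I_n) (c : bool) :
  deviate a i c i = c.
Proof. by rewrite ffunE eqxx. Qed.

Lemma transitionE (R : realType) (n : nat) (E : {set {set 'I_n}}) (alpha : R)
    (S : {set 'I_n}) (beta : R) (a b : joint_action n) :
  transition E alpha S beta a b =
  \sum_(i < n) n%:R^-1 *
    (prob E alpha S beta a i (b i) * (b == deviate a i (b i))%:R).
Proof.
apply: eq_bigr => i _; congr (_ * _); rewrite /prob /act_x /act_y.
case bi: (b i).
  rewrite (_ : (b == deviate a i false) = false) ?mulr0 ?addr0 //.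
  by apply/negP => /eqP b_dev; rewrite b_dev deviate_at in bi.
rewrite (_ : (b == deviate a i true) = false) ?mulr0 ?add0r //.
by apply/negP => /eqP b_dev; rewrite b_dev deviate_at in bi.
Qed.

Lemma prob_gt0 (R : realType) (n : nat) (E : {set {set 'I_n}}) (alpha : R)
    (S : {set 'I_n}) (beta : R) (a : joint_action n) (i : 'I_n) (c : bool) :
  simple_graph E -> 0 < prob E alpha S beta a i c.
Proof. by move=> hE; rewrite prob_gibbs // divr_gt0 ?addr_gt0 ?expR_gt0. Qed.

Lemma transition_ge0 (R : realType) (n : nat) (E : {set {set 'I_n}}) (alpha : R)
    (S : {set 'I_n}) (beta : R) (a b : joint_action n) :
  simple_graph E -> 0 <= transition E alpha S beta a b.
Proof.
move=> hE; rewrite transitionE sumr_ge0 // => i _.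
by rewrite !mulr_ge0 ?invr_ge0 ?ler0n // ltW // prob_gt0.
Qed.

Lemma transition_sum1 (R : realType) (n : nat) (E : {set {set 'I_n}})
    (alpha : R) (S : {set 'I_n}) (beta : R) (a : joint_action n) :
  (0 < n)%N -> \sum_b transition E alpha S beta a b = 1.
Proof.
move=> hn; rewrite exchange_big /=.
have sum_eq (c : joint_action n) : \sum_b (b == c)%:R = 1 :> R.
  by rewrite (bigD1 c) //= eqxx big1 ?addr0 // => b /negPf ->.
under eq_bigr => i _.
  rewrite -mulr_sumr big_split /= -!mulr_sumr !sum_eq !mulr1.
  rewrite [X in _ * X]addrC subrK mulr1; over.
by rewrite sumr_const card_ord -[LHS]mulr_natr mulVf // pnatr_eq0 -lt0n.
Qed.

Lemma transition_reversible (R : realType) (n : nat) (E : {set {set 'I_n}})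
    (alpha : R) (S : {set 'I_n}) (beta : R) (a b : joint_action n) :
  simple_graph E ->
  expR (beta * potential E alpha S a) * transition E alpha S beta a b =
  expR (beta * potential E alpha S b) * transition E alpha S beta b a.
Proof.
move=> hE; rewrite !transitionE !mulr_sumr; apply: eq_bigr => i _.
case: (eqVneq b (deviate a i (b i))) => [b_dev|b_dev]; last first.
  rewrite (_ : (a == deviate b i (a i)) = false) ?mulr0 //.
  apply: contra_neqF b_dev => /eqP ->.
  by rewrite deviate_deviate deviate_self.
have a_dev : a = deviate b i (a i).
  by rewrite b_dev deviate_deviate deviate_self.
have same c : deviate b i c = deviate a i c by rewrite b_dev deviate_deviate.
rewrite -a_dev eqxx !prob_gibbs // !same -b_dev deviate_self; ring.
Qed.

Lemma transition_deviate_gt0 (R : realType) (n : nat) (E : {set {set 'I_n}})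
    (alpha : R) (S : {set 'I_n}) (beta : R) (a : joint_action n) (i : 'I_n)
    (c : bool) :
  simple_graph E -> 0 < transition E alpha S beta a (deviate a i c).
Proof.
move=> hE; have n_gt0 : (0 < n)%N := leq_ltn_trans (leq0n i) (ltn_ord i).
rewrite transitionE (bigD1 i) //= deviate_at eqxx mulr1 ltr_wpDr //.
  apply: sumr_ge0 => j _.
  by rewrite !mulr_ge0 ?invr_ge0 ?ler0n // ltW // prob_gt0.
by rewrite mulr_gt0 ?invr_gt0 ?ltr0n // prob_gt0.
Qed.

Lemma transition_connected (R : realType) (n : nat) (E : {set {set 'I_n}})
    (alpha : R) (S : {set 'I_n}) (beta : R) (a b : joint_action n) :
  simple_graph E -> connect [rel c d | 0 < transition E alpha S beta c d] a b.
Proof.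
move=> hE.
pose mix (A : {set 'I_n}) : joint_action n :=
  [ffun j => if j \in A then b j else a j].
suff mix_conn m (A : {set 'I_n}) : #|A| = m ->
    connect [rel c d | 0 < transition E alpha S beta c d] a (mix A).
  have <- : mix [set: 'I_n] = b by apply/ffunP => j; rewrite ffunE inE.
  exact: mix_conn erefl.
elim: m A => [|m IHm] A cardA.
  suff -> : mix A = a by exact: connect0.
  by apply/ffunP => j; rewrite ffunE (cards0_eq cardA) inE.
have /card_gt0P [i iA] : (0 < #|A|)%N by rewrite cardA.
have cardAi : #|A :\ i| = m by move: cardA; rewrite (cardsD1 i) iA => -[].
apply: connect_trans (IHm _ cardAi) (connect1 _) => /=.
have -> : mix A = deviate (mix (A :\ i)) i (b i).
  by apply/ffunP => j; rewrite !ffunE !inE; case: eqP => [->|//]; rewrite iA.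
exact: transition_deviate_gt0.
Qed.

Lemma gibbs_unique_stationary (R : realType) (n : nat) (E : {set {set 'I_n}})
    (alpha : R) (S : {set 'I_n}) (beta : R) :
  (0 < n)%N -> simple_graph E ->
  unique (stationary (transition E alpha S beta))
    (gibbs (potential E alpha S) beta).
Proof.
move=> hn hE; apply: (reversible_unique_stationary (all_x n)) =>
  [a|a b|a|a b|a b].
- exact: expR_gt0.
- exact: transition_ge0.
- exact: transition_sum1.
- exact: transition_reversible.
- exact: transition_connected.
Qed.

Lemma stochastically_stable_max (R : realType) (n : nat) (E : {set {set 'I_n}})
    (alpha : R) (S : {set 'I_n}) (m : joint_action n) :
  (0 < n)%N -> simple_graph E ->
  strictly_stochastically_stable E alpha S m <->
  forall a, a != m -> potential E alpha S a < potential E alpha S m.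
Proof.
move=> hn hE; split=> [[pi [[pi_ [pi_stat pi_cvg]] pi_m]] a am|m_max].
  apply: gibbs_cvg1_max am _; rewrite -pi_m.
  apply: cvg_trans (pi_cvg m); apply: near_eq_cvg; near=> beta.
  have beta_gt0 : 0 < beta.
    by near: beta; apply: nbhs_pinfty_gt; exact: num_real.
  have [_] := gibbs_unique_stationary alpha S beta hn hE.
  by move=> /(_ _ (pi_stat beta beta_gt0).1) <-.
exists (fun a => (a == m)%:R); split; last by rewrite eqxx.
exists (gibbs (potential E alpha S)); split=> [beta _|a].
  exact: gibbs_unique_stationary.
case: eqVneq => [->|am]; first exact: gibbs_cvg1.
exact/gibbs_cvg0/m_max.
Unshelve. all: by end_near. Qed.

Lemma edge_countE (n : nat) (E : {set {set 'I_n}}) (A B : {set 'I_n}) :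
  edge_count E A B =
  (\sum_(e in E) [exists i in A, exists j in B, e == [set i; j]])%N.
Proof.
rewrite /edge_count -sum1_card big_mkcond [RHS]big_mkcond /=.
by apply: eq_bigr => e _; rewrite inE; case: (e \in E).
Qed.

Lemma edge_betweenE (n : nat) (A B : {set 'I_n}) (i j : 'I_n) :
  [exists k in A, exists l in B, [set i; j] == [set k; l]] =
  (i \in A) && (j \in B) || (j \in A) && (i \in B).
Proof.
apply/existsP/idP => [[k /andP[kA /existsP [l /andP[lB /eqP ij]]]]|].
  have : i \in [set k; l] by rewrite -ij finset.set21.
  have : j \in [set k; l] by rewrite -ij finset.set22.
  have : k \in [set i; j] by rewrite ij finset.set21.
  have : l \in [set i; j] by rewrite ij finset.set22.
  by rewrite !inE; do 4!(case/orP => /eqP ?); subst; rewrite ?kA ?lB ?orbT.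
case/orP => /andP[? ?]; [exists i|exists j];
  apply/andP; split=> //; apply/existsP.
  by exists j; apply/andP.
by exists i; rewrite finset.setUC eqxx andbT.
Qed.

Lemma edge_count_within (n : nat) (E : {set {set 'I_n}}) (A : {set 'I_n}) :
  simple_graph E -> edge_count E A A = (\sum_(e in E) (e \subset A))%N.
Proof.
move=> hE; rewrite edge_countE.
apply: eq_bigr => e /hE/eqP/cards2P[i [j [_ ->]]].
rewrite edge_betweenE finset.subUset !finset.sub1set.
by case: (i \in A); case: (j \in A).
Qed.

Lemma edge_count_touching (n : nat) (E : {set {set 'I_n}}) (A : {set 'I_n}) :
  simple_graph E ->
  (edge_count E A [set: 'I_n] + edge_count E (~: A) (~: A))%N = #|E|.
Proof.
move=> hE; rewrite !edge_countE -big_split -sum1_card /=.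
apply: eq_bigr => e /hE/eqP/cards2P[i [j [_ ->]]].
by rewrite !edge_betweenE !inE; case: (i \in A); case: (j \in A).
Qed.

Lemma edge_count_cut (n : nat) (E : {set {set 'I_n}}) (A : {set 'I_n}) :
  simple_graph E ->
  (edge_count E A (~: A) + edge_count E A A + edge_count E (~: A) (~: A))%N
  = #|E|.
Proof.
move=> hE; rewrite !edge_countE -!big_split -sum1_card /=.
apply: eq_bigr => e /hE/eqP/cards2P[i [j [_ ->]]].
by rewrite !edge_betweenE !inE; case: (i \in A); case: (j \in A).
Qed.

Lemma edge_count0 (n : nat) (E : {set {set 'I_n}}) (B : {set 'I_n}) :
  edge_count E finset.set0 B = 0%N.
Proof.
rewrite edge_countE big1 // => e _; apply/eqP; rewrite eqb0.
by apply/existsP => -[i]; rewrite inE.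
Qed.

Definition y_on (n : nat) (T : {set 'I_n}) : joint_action n :=
  [ffun i => i \notin T].

Lemma y_on_surj (n : nat) (a : joint_action n) : y_on [set i | ~~ a i] = a.
Proof. by apply/ffunP => i; rewrite ffunE inE negbK. Qed.

Lemma y_on0 (n : nat) : y_on finset.set0 = all_x n.
Proof. by apply/ffunP => i; rewrite !ffunE inE. Qed.

Lemma y_onT (n : nat) : y_on [set: 'I_n] = all_y n.
Proof. by apply/ffunP => i; rewrite !ffunE inE. Qed.

Lemma y_on_inj (n : nat) : injective (@y_on n).
Proof.
move=> T U /ffunP TU; apply/setP => i.
by have := TU i; rewrite !ffunE => /negb_inj.
Qed.

Lemma potential_y_on (R : realType) (n : nat) (E : {set {set 'I_n}}) (alpha : R)
    (S T : {set 'I_n}) : simple_graph E ->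
  potential E alpha S (y_on T) =
  (1 + alpha) * (edge_count E (~: T) (~: T))%:R + (edge_count E T T)%:R
  + #|T :&: S|%:R.
Proof.
move=> hE; rewrite /potential !edge_count_within // big_split /=.
have -> : [set i | y_on T i] = ~: T by apply/setP => i; rewrite !inE ffunE.
have -> : [set i | ~~ y_on T i] = T.
  by apply/setP => i; rewrite !inE ffunE negbK.
rewrite sumrMnr mulr_natr natr_sum; congr (_ + _).
rewrite -sum1_card natr_sum big_mkcond [RHS]big_mkcond /=.
apply: eq_bigr => i _.
by rewrite inE ffunE negbK; case: (i \in S); case: (i \in T).
Qed.

Lemma potential_all_x_sub (R : realType) (n : nat) (E : {set {set 'I_n}})
    (alpha : R) (S T : {set 'I_n}) : simple_graph E ->
  potential E alpha S (y_on finset.set0) - potential E alpha S (y_on T) =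
  alpha * (edge_count E T [set: 'I_n])%:R
  - (#|T :&: S|%:R - (edge_count E T (~: T))%:R).
Proof.
move=> hE; rewrite !potential_y_on // finset.set0I cards0 edge_count0.
have := edge_count_touching finset.set0 hE; rewrite edge_count0 add0n => ->.
have := edge_count_cut T hE; rewrite -(edge_count_touching T hE).
by move=> /addIn <-; rewrite !natrD; ring.
Qed.

Lemma potential_all_y_sub (R : realType) (n : nat) (E : {set {set 'I_n}})
    (alpha : R) (S T : {set 'I_n}) : simple_graph E ->
  potential E alpha S (y_on [set: 'I_n]) - potential E alpha S (y_on T) =
  (edge_count E T (~: T))%:R + #|S|%:R - #|T :&: S|%:R
  - alpha * (edge_count E (~: T) (~: T))%:R.
Proof.
move=> hE; rewrite !potential_y_on // finset.setTI finset.setCT edge_count0.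
have := edge_count_touching [set: 'I_n] hE.
rewrite finset.setCT edge_count0 addn0 => ->.
by rewrite -(edge_count_cut T hE) !natrD; ring.
Qed.

Lemma stochastically_stable_y_on (R : realType) (n : nat)
    (E : {set {set 'I_n}}) (alpha : R) (S U : {set 'I_n}) :
  (0 < n)%N -> simple_graph E ->
  strictly_stochastically_stable E alpha S (y_on U) <->
  forall T, T != U ->
    potential E alpha S (y_on T) < potential E alpha S (y_on U).
Proof.
move=> hn hE; rewrite stochastically_stable_max //; split=> max_U.
  by move=> T TU; apply: max_U; rewrite (inj_eq (@y_on_inj n)).
by move=> a; rewrite -(y_on_surj a) (inj_eq (@y_on_inj n)); exact: max_U.
Qed.

Lemma gt_quotP (R : realType) (a p q : R) :
  0 <= q -> reflect (gt_quot a p q) (p < a * q).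
Proof.
rewrite /gt_quot le_eqVlt eq_sym; case: eqVneq => [-> _|_ /= q_gt0].
  by rewrite mulr0; exact: idP.
by rewrite -ltr_pdivrMr //; exact: idP.
Qed.

Lemma lt_quotP (R : realType) (a p q : R) :
  0 <= q -> reflect (lt_quot a p q) (a * q < p).
Proof.
rewrite /lt_quot le_eqVlt eq_sym; case: eqVneq => [-> _|_ /= q_gt0].
  by rewrite mulr0; exact: idP.
by rewrite -ltr_pdivlMr //; exact: idP.
Qed.

Theorem theorem1 (R : realType) (n : nat) (hn : (0 < n)%N)
    (E : {set {set 'I_n}}) (hE : simple_graph E) (alpha : R)
    (k : nat) (S : {set 'I_n}) (hS : #|S| = k) :
  (strictly_stochastically_stable E alpha S (all_x n) <->
   forall T : {set 'I_n}, T != finset.set0 ->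
     gt_quot alpha
       (#|T :&: S|%:R - (edge_count E T (~: T))%:R)
       (edge_count E T [set: 'I_n])%:R)
  /\
  (strictly_stochastically_stable E alpha S (all_y n) <->
   forall T : {set 'I_n}, T != [set: 'I_n] ->
     lt_quot alpha
       ((edge_count E T (~: T))%:R + k%:R - #|T :&: S|%:R)
       (edge_count E (~: T) (~: T))%:R).
Proof.
rewrite -y_on0 -y_onT -hS; split; rewrite stochastically_stable_y_on //.
  split=> H T TU; have := H T TU;
    rewrite -subr_gt0 potential_all_x_sub // subr_gt0.
    by move/(gt_quotP _ _ (ler0n R _)).
  by move/(gt_quotP _ _ (ler0n R _)).
split=> H T TU; have := H T TU;
  rewrite -subr_gt0 potential_all_y_sub // subr_gt0.
  by move/(lt_quotP _ _ (ler0n R _)).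
by move/(lt_quotP _ _ (ler0n R _)).
Qed.
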